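(* Let $n\ge 1$, let $f:\{0,1\}^n\to\{0,1\}$ be a total Boolean function and let $C\subseteq\{0,1\}^n$ (a constraint). Let $f_C:\{0,1\}^n\to\{0,1,*\}$ be the partial Boolean function with $f_C(\mathbf{x})=f(\mathbf{x})$ if $\mathbf{x}\in C$ and $f_C(\mathbf{x})=*$ otherwise. Suppose $\mathbf{x}\in C$ is a positive instance of $f$, i.e. $f(\mathbf{x})=1$. Then every sufficient reason of $f(\mathbf{x})=1$ is subsumed by some sufficient reason of $f_C(\mathbf{x})=1$.
   Context: Fix Boolean variables $X_1,\dots,X_n$. An instance is an element of $\{0,1\}^n$, viewed as a truth assignment to $X_1,\dots,X_n$. A literal is a variable $X_i$ or its negation $\lnot X_i$. A term is a conjunction of literals (the empty conjunction is $\top$, true everywhere). For a term $t$, $[t]\subseteq\{0,1\}^n$ is the set of instances satisfying $t$. Terms $s,t$ with $[s]=[t]$ are logically equivalent and are not distinguished. A term $s$ subsumes a term $t$ (equivalently, $t$ is subsumed by $s$) if $[t]\subseteq[s]$. A partial Boolean function is a function $g:\{0,1\}^n\to\{0,1,*\}$; write $g^i=g^{-1}(i)$ for $i\in\{0,1,*\}$. It is total if $g^*=\emptyset$. A positive instance of $g$ is an element of $g^1$. A term $t$ is an implicant of $g$ if $[t]\subseteq g^1\cup g^*$. An implicant $t$ of $g$ is prime if no other implicant of $g$ (i.e., none not logically equivalent to $t$) subsumes $t$. If $\mathbf{x}$ is a positive instance of $g$, a sufficient reason of $g(\mathbf{x})=1$ is a term $t$ such that (i) $t$ is a prime implicant of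 $g$, and (ii) $t$ is satisfied by $\mathbf{x}$, i.e. $\mathbf{x}\in[t]$. *)

(* Defs.v *)
From mathcomp Require Import all_boot.

Set Implicit Arguments.
Unset Strict Implicit.
Unset Printing Implicit Defensive.

Definition instance (n : nat) := {ffun 'I_n -> bool}.

(* (i, true) is the literal X_i and (i, false) is its negation. *)
Definition literal (n : nat) := ('I_n * bool)%type.

Definition lit_sat (n : nat) (x : instance n) (l : literal n) : bool :=
  x l.1 == l.2.

(* A term is the conjunction of a finite set of literals. Opposite literals may
   occur together, so contradictory terms are allowed. Distinct sets may be
   logically equivalent; whenever terms are compared, it is through the sets of
   instances that satisfy them. *)
Definition term (n : nat) := {set literal n}.

Definition models (n : nat) (t : term n) : {set instance n} :=
  [set x | [forall l in t, lit_sat x l]].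

Definition term_equiv (n : nat) (s t : term n) : Prop := models s = models t.

Definition subsumes (n : nat) (s t : term n) : Prop := models t \subset models s.

(* [None] is the undefined value "*". *)
Definition partial_boolfun (n : nat) := instance n -> option bool.

Definition value_preim (n : nat) (g : partial_boolfun n) (v : option bool) :
  {set instance n} := [set x | g x == v].

Definition of_total (n : nat) (f : instance n -> bool) : partial_boolfun n :=
  fun x => Some (f x).

Definition constrain (n : nat) (f : instance n -> bool) (C : {set instance n}) :
  partial_boolfun n := fun x => if x \in C then Some (f x) else None.

Definition implicant (n : nat) (g : partial_boolfun n) (t : term n) : Prop :=
  models t \subset value_preim g (Some true) :|: value_preim g None.

Definition prime_implicant (n : nat) (g : partial_boolfun n) (t : term n) :
  Prop :=
  implicant g t /\
  ~ (exists s : term n, [/\ implicant g s, ~ term_equiv s t & subsumes s t]).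

(* Only meaningful when [g x = Some true]. *)
Definition sufficient_reason (n : nat) (g : partial_boolfun n)
  (x : instance n) (t : term n) : Prop :=
  prime_implicant g t /\ x \in models t.

(* Main.v *)
Require Import Defs.
From mathcomp Require Import all_boot.

(** Restricting [f] to [C] only turns some values into [None], which an implicant may cover, so
    implicants of [f] stay implicants of [constrain f C]. Primality may be lost; passing to an
    implicant with the most models among those subsuming the term restores it, and [x] remains a
    model. *)

(* Among the implicants of [g] that subsume [t], one with the most models is
   prime. *)
Lemma implicant_subsumed_by_prime (n : nat) (g : partial_boolfun n)
  (t : term n) (gt : implicant g t) :
  exists s : term n, prime_implicant g s /\ subsumes s t.
Proof.
pose good (s : term n) :=
  (models s \subset value_preim g (Some true) :|: value_preim g None)
  && (models t \subset models s).
have good_t : good t by rewrite /good subxx andbT.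
case: (arg_maxnP (fun s : term n => #|models s|) good_t).
move=> s /andP[gs st] s_max; exists s; do 2!split=> //.
case=> u [gu neq_us us]; apply: neq_us; apply/esym/eqP.
(* Inclusion and maximal cardinality force equality; [u] competes with [s] since it also subsumes
   [t]. *)
rewrite eqEcard us; apply: s_max.
by apply/andP; split=> //; apply: subset_trans st us.
Qed.

Lemma implicant_constrain (n : nat) (f : instance n -> bool)
  (C : {set instance n}) (t : term n) :
  implicant (of_total f) t -> implicant (constrain f C) t.
Proof.
move=> ft; apply: subset_trans ft _; apply/subsetP=> y.
(* [of_total f] never takes the value [None], so [f y] is true here. *)
rewrite !inE /of_total /constrain orbF => /eqP ->.
by case: (y \in C).
Qed.

Theorem proposition1 (n : nat) (n_ge1 : 1 <= n) (f : instance n -> bool)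
  (C : {set instance n}) (x : instance n) (xC : x \in C) (fx : f x = true)
  (t : term n) (ht : sufficient_reason (of_total f) x t) :
  exists s : term n, sufficient_reason (constrain f C) x s /\ subsumes s t.
Proof.
case: ht => [[ft _] xt].
have [s [s_prime st]] :=
  implicant_subsumed_by_prime _ _ _ (implicant_constrain _ _ C _ ft).
by exists s; do 2!split=> //; apply: (subsetP st).
Qed.
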